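(* Let $G$ be a finite group and let $p$ be a fixed prime divisor of $|G|$. Suppose that every maximal subgroup of $G$ is nilpotent, or normal in $G$, or has order not divisible by $p$. Then $G$ has a Sylow tower.
   Context: A finite group $G$ has a Sylow tower if, writing the distinct prime divisors of $|G|$ in a suitable order $p_1,\dots,p_s$ and taking $P_i\in\mathrm{Syl}_{p_i}(G)$, there is a chain of normal subgroups $P_1\trianglelefteq P_1P_2\trianglelefteq P_1P_2P_3\trianglelefteq\cdots\trianglelefteq P_1P_2\cdots P_s=G$, each term $P_1\cdots P_i$ being normal in $G$. *)

(* Defs.v *)
From mathcomp Require Import all_boot all_fingroup all_solvable.
Set Implicit Arguments. Unset Strict Implicit. Unset Printing Implicit Defensive.

Definition sylow_tower (gT : finGroupType) (G : {set gT}) : Prop :=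
  exists (s : seq nat) (P : nat -> {group gT}),
    [/\ perm_eq s (primes #|G|),
        forall p, p \in s -> (p.-Sylow(G) (P p))%g,
        forall i, i <= size s ->
          group_set (\prod_(p <- take i s) (P p : {set gT}))%g
          && ((\prod_(p <- take i s) (P p : {set gT})) <| G)%g
      & (\prod_(p <- s) (P p : {set gT}))%g = G].

(* Main.v *)
(** Let P be a Sylow p-subgroup of G.  If P is not normal, the Frattini argument
shows that a maximal subgroup above N_G(P) is not normal, so it is nilpotent and
equals N_G(P).

The key point is that G is then p-nilpotent.  Modding out O_p'(G) and O_p(G)
(the latter with Schur-Zassenhaus) leaves the case where both are trivial.  Take
a minimal normal subgroup N: it is perfect, hence lies in every normal maximal
subgroup.  If P were not in N, each Sylow normaliser of N would lie in a
nilpotent maximal subgroup conjugate to N_G(P), forcing N into N_G(P).  So P lies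
in N, and the normaliser of any nontrivial p-subgroup, which contains C_G(S) for
some Sylow p-subgroup S, lies in a nilpotent maximal subgroup.  Hence Sylow
p-subgroups are TI, N_G(P) controls fusion in P, and transfer gives
P = P /\ G' <= P', a contradiction.

Once G is p-nilpotent, any P-invariant Sylow r-subgroup is normal in G or lies in
N_G(P), so G = T N_G(P) with T the product of the normal Sylow subgroups, and G/T
is nilpotent.  If P is normal, every maximal subgroup of G/P is nilpotent or
normal, and the previous case applies to G/P for any prime whose Sylow subgroup
is not normal. *)

Require Import Defs.
From mathcomp Require Import all_boot all_fingroup all_solvable ssralg.

Set Implicit Arguments. Unset Strict Implicit. Unset Printing Implicit Defensive.

Local Open Scope group_scope.

Import GRing.Theory FiniteModule.

(** * Sylow subgroups and transfer *)

Lemma subset_Sylows (gT : finGroupType) (H K : {group gT}) :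
  (forall r, r \in \pi(K) ->
     exists2 R : {group gT}, r.-Sylow(K) R & R \subset H) ->
  K \subset H.
Proof.
move=> sylH; apply/setIidPl/eqP; rewrite eqEcard subsetIl dvdn_leq //.
apply/dvdn_partP => // r /sylH[R sylR sRH].
by rewrite -(card_Hall sylR) cardSg // subsetI (pHall_sub sylR).
Qed.

(** Focal subgroup argument: the transfer to [S] modulo its derived subgroup kills that of [G], and
    the fusion hypothesis makes it the [#|G : S|]-th power map on [S], an exponent prime to
    [#|S|]. *)
Lemma der1_setI_Sylow (gT : finGroupType) (p : nat) (G S : {group gT}) :
    p.-Sylow(G) S ->
    (forall x g, x \in S -> g \in G -> x ^ g \in S -> [~ x, g] \in S^`(1)) ->
  S :&: G^`(1) \subset S^`(1).
Proof.
move=> sylS fusS; set K := S^`(1); have [sSG coSiSG] := andP (pHall_Hall sylS).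
apply/subsetP=> g /setIP[Sg G'g]; have Gg := subsetP sSG g Sg.
have nKS: S \subset 'N(K) by apply: der_norm.
set alpha := restrm_morphism nKS (coset_morphism K).
have alphim: (alpha @* S) = (S / K) by rewrite morphim_restrm setIid.
have abelSK : abelian (alpha @* S) by rewrite alphim sub_der1_abelian.
have G'ker : G^`(1) \subset 'ker (transfer G abelSK).
  rewrite gen_subG; apply/subsetP=> h; case/imset2P=> h1 h2 Gh1 Gh2 ->{h}.
  by rewrite !inE groupR // morphR //; apply/commgP; apply: addrC.
have transg0: transfer G abelSK g = 0%R.
  by move/kerP: (subsetP G'ker g G'g); apply.
have partX := rcosets_cycle_partition sSG Gg.
have trX := transversalP partX; set X := transversal _ _ in trX.
have sXG := transversal_sub trX.
have gGSeq0: (fmod abelSK (alpha g) *+ #|G : S| = 0)%R.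
  rewrite -transg0 (transfer_cycle_expansion sSG abelSK Gg trX).
  rewrite -(sum_index_rcosets_cycle sSG Gg trX) -sumrMnr /restrm.
  apply: eq_bigr=> x Xx; rewrite -[(_ *+ _)%R]morphX ?mem_morphim //=.
  rewrite -morphX //= /restrm; congr fmod.
  (* Each transfer factor is a G-conjugate of a power of g that lies in S, so it
     is congruent to that power modulo S'. *)
  have Sgx: (g ^+ #|<[g]> : S :* x|) ^ x^-1 \in S.
    by rewrite conjgE invgK mulgA -mem_rcoset; apply: mulg_exp_card_rcosets.
  apply/esym/rcoset_kercosetP; rewrite /= -/K ?(subsetP nKS) ?groupX //.
  rewrite mem_rcoset conjg_mulR.
  rewrite -mulgA -{1}[g ^+ _]invgK -conjgE.
  rewrite memJ_norm ?groupV ?(subsetP nKS) ?groupX //.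
  by rewrite fusS ?groupX // groupV (subsetP sXG).
move: (congr_fmod gGSeq0).
rewrite fmval0 morphX ?inE //= fmodK ?mem_morphim // /restrm /=.
move/(congr1 (fun z => z ^+ (expg_invn (S / K) #|G : S|))).
rewrite expg1n expgK ?mem_quotient ?coprime_morphl // => Kg1.
by rewrite coset_idr ?(subsetP nKS).
Qed.

(** * Maximal subgroups above Sylow normalisers *)

Definition tame_maximals (p : nat) (gT : finGroupType) (G : {group gT}) : Prop :=
  forall M : {group gT}, maximal M G ->
    [\/ nilpotent M, M <| G | ~~ (p %| #|M|)].

Lemma tame_quotient (gT : finGroupType) (p : nat) (G N : {group gT}) :
  N <| G -> tame_maximals p G -> tame_maximals p (G / N)%G.
Proof.
move=> nsNG tameG M maxM; pose H := (coset N @*^-1 M)%G.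
have maxH: maximal H G by rewrite -(quotientGK nsNG) cosetpre_maximal.
have defM: M :=: H / N by rewrite cosetpreK.
have nsNH: N <| H.
  by rewrite (normalS _ _ nsNG) ?sub_cosetpre ?(proper_sub (maxgroupp maxH)).
case: (tameG H maxH) => [nilH | nsHG | p'H].
- by constructor 1; rewrite defM quotient_nil.
- by constructor 2; rewrite defM quotient_normal.
- constructor 3; apply: contra p'H; rewrite defM => /dvdn_trans-> //.
  exact: dvdn_quotient.
Qed.

(** By the Frattini argument [G] is [K] times ['N_G(R)], so [H] cannot contain both factors. *)
Lemma maximal_norm_Sylow_not_sub (gT : finGroupType) (r : nat)
    (G K R H : {group gT}) :
    K <| G -> r.-Sylow(K) R -> maximal H G -> 'N_G(R) \subset H ->
  ~~ (K \subset H).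
Proof.
move=> nsKG sylR /maxgroupp/properP[_ [x Gx notHx]] sNH.
apply: contra notHx => sKH; move: Gx; rewrite -(Frattini_arg nsKG sylR).
by apply/subsetP; rewrite mul_subG.
Qed.

(** If [H] were normal, the previous lemma would apply to [K :&: H], a normal subgroup of [G] inside
    [H] with Sylow subgroup [R]. *)
Lemma maximal_norm_Sylow_not_normal (gT : finGroupType) (r : nat)
    (G K R H : {group gT}) :
    K <| G -> r.-Sylow(K) R -> maximal H G -> 'N_G(R) \subset H ->
  ~~ (H <| G).
Proof.
move=> nsKG sylR maxH sNH; apply/negP=> nsHG.
have sRK := pHall_sub sylR; have sRG := subset_trans sRK (normal_sub nsKG).
have sRH: R \subset H by apply: subset_trans sNH; rewrite subsetI sRG normG.
have nsKHG : K :&: H <| G by apply: normalI.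
have sylRKH : r.-Sylow(K :&: H) R.
  by apply: pHall_subl sylR; rewrite ?subsetI ?sRK ?subsetIl.
have /negP[] := maximal_norm_Sylow_not_sub nsKHG sylRKH maxH sNH.
exact: subsetIr.
Qed.

(** Since ['O_p(G)] is trivial, ['O_p(H)] is not normal in [G], so by maximality [H] is its
    normaliser. As it is Sylow in [H] and normalisers grow in p-groups, it is Sylow in [G]. *)
Lemma nilpotent_maximal_Sylow (gT : finGroupType) (p : nat) (G H : {group gT}) :
    'O_p(G) = 1 -> maximal H G -> nilpotent H -> p %| #|H| -> prime p ->
  p.-Sylow(G) 'O_p(H) /\ 'N_G('O_p(H)) = H.
Proof.
move=> Op1 maxH nilH pH p_pr; have [sHG _] := andP (maxgroupp maxH).
have hallO := nilpotent_pcore_Hall p nilH.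
have ntO: 'O_p(H) != 1.
  by rewrite -cardG_gt1 (card_Hall hallO) p_part_gt1 mem_primes p_pr cardG_gt0.
have sHN: H \subset 'N_G('O_p(H)) by rewrite subsetI sHG gFnorm.
have [_ maxHG] := maxgroupP maxH.
have defN: 'N_G('O_p(H)) = H.
  apply: maxHG => //; rewrite properE subsetIl subsetI subxx /=.
  apply: contra ntO => nOG; rewrite -subG1 -Op1 pcore_max ?pcore_pgroup //.
  by rewrite /normal gFsub_trans.
split=> //.
have [S sylS sOS] := Sylow_superset (gFsub_trans _ sHG) (pcore_pgroup p H).
suffices ->: 'O_p(H) = S by [].
apply/esym/(nilpotent_sub_norm (pgroup_nil (pHall_pgroup sylS)) sOS).
rewrite (sub_Hall_pcore hallO).
  by apply: pgroupS (pHall_pgroup sylS); apply: subsetIl.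
by apply: subset_trans (setSI _ (pHall_sub sylS)) _; rewrite defN.
Qed.

Lemma Sylow_norm_maximal (gT : finGroupType) (p : nat) (G P : {group gT}) :
    tame_maximals p G -> p.-Sylow(G) P -> ~~ (P <| G) ->
  maximal 'N_G(P) G /\ nilpotent 'N_G(P).
Proof.
move=> tameG sylP not_nsPG; have [sPG pP _] := and3P sylP.
have [defN | [H maxH sNH]] := maximal_exists (subsetIl G 'N(P)).
  by case/negP: not_nsPG; rewrite /normal sPG -{1}defN subsetIr.
have sPH: P \subset H by apply: subset_trans sNH; rewrite subsetI sPG normG.
have nilH: nilpotent H.
  have [//||/negP[]] := tameG H maxH.
    by rewrite (negPf (maximal_norm_Sylow_not_normal _ sylP maxH sNH)).
  have [|p_pr pP' _] := pgroup_pdiv pP.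
    by apply: contra not_nsPG => /eqP->; apply: normal1.
  by rewrite (dvdn_trans pP') ?cardSg.
have sHG := proper_sub (maxgroupp maxH).
suffices -> : 'N_G(P) = H by [].
apply/eqP; rewrite eqEsubset sNH subsetI sHG.
rewrite (nilpotent_Hall_pcore nilH (pHall_subl sPH sHG sylP)).
exact: gFnorm.
Qed.

(** [G / H] is cyclic, generated by any element outside [H], so [H] contains the derived subgroup of
    [G]. *)
Lemma perfect_sub_normal_maximal (gT : finGroupType) (G H N : {group gT}) :
  N^`(1) = N -> N \subset G -> maximal H G -> H <| G -> N \subset H.
Proof.
move=> perfN sNG maxH nsHG; have [sHG nHG] := andP nsHG.
have /properP[_ [x Gx notHx]] := maxgroupp maxH.
rewrite -perfN (subset_trans (dergS 1 sNG)) // der1_min //.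
rewrite -(mulg_normal_maximal nsHG maxH (_ : <[x]> \subset G)) ?cycle_subG //.
by rewrite quotientMidl quotient_abelian ?cycle_abelian.
Qed.

(** * Groups with trivial p-core and p'-core *)

Lemma nilpotent_normal_trivg (gT : finGroupType) (p : nat) (G N : {group gT}) :
    'O_p(G) = 1 -> 'O_p^'(G) = 1 -> N <| G -> nilpotent N ->
  N :=: 1.
Proof.
move=> Op1 Op'1 nsNG nilN.
have core1 pi : 'O_pi(G) = 1 -> 'O_pi(N) = 1.
  by move=> O1; rewrite -(pcore_setI_normal pi nsNG) O1 (setIidPl (sub1G _)).
by rewrite -(nilpotent_pcoreC p nilN) !core1 // dprodg1.
Qed.

Lemma perfect_minnormal (gT : finGroupType) (p : nat) (G N : {group gT}) :
    'O_p(G) = 1 -> 'O_p^'(G) = 1 -> minnormal N G -> N \subset G ->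
  N^`(1) = N.
Proof.
move=> Op1 Op'1 /mingroupP[/andP[ntN nNG] minN] sNG.
apply: minN; last exact: der_sub.
rewrite gFnorm_trans // andbT; apply: contra ntN => /eqP/derG1P abN.
by rewrite (nilpotent_normal_trivg Op1 Op'1 _ (abelian_nil abN)) // /normal sNG.
Qed.

Lemma nilpotent_norm_Sylow_sub (gT : finGroupType) (p : nat) (G P : {group gT}) :
    nilpotent 'N_G(P) -> p.-Sylow(G) P ->
  'N_G(P) \subset P * 'C_G(P).
Proof.
move=> nilM sylP; have [sPG pP _] := and3P sylP.
have sPM: P \subset 'N_G(P) by rewrite subsetI sPG normG.
have defP := nilpotent_Hall_pcore nilM (pHall_subl sPM (subsetIl _ _) sylP).
have [_ defM cPA _] := dprodP (nilpotent_pcoreC p nilM).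
rewrite -{1}defM -defP mulgS // subsetI (gFsub_trans _ (subsetIl _ _)) //=.
by rewrite {2}defP.
Qed.

(* Two Sylow subgroups with maximal nontrivial intersection D both grow into the
   Sylow p-subgroup of a nilpotent maximal subgroup above 'N_G(D). *)
Lemma Sylow_TI (gT : finGroupType) (p : nat) (G : {group gT}) :
    'O_p(G) = 1 -> prime p ->
    (forall D : {group gT}, D \subset G -> p.-group D -> D :!=: 1 ->
       exists H : {group gT},
         [/\ maximal H G, nilpotent H & 'N_G(D) \subset H]) ->
  forall S T : {group gT}, p.-Sylow(G) S -> p.-Sylow(G) T -> S :&: T != 1 ->
    S :=: T.
Proof.
move=> Op1 p_pr nilN S T; have [n] := ubnP (#|G| - #|S :&: T|).
elim: n => // n IHn in S T * => /ltnSE-leGn sylS sylT ntD.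
have [sSG pS _] := and3P sylS; have [sTG pT _] := and3P sylT.
set D := (S :&: T)%G in ntD leGn.
have sDG : D \subset G by apply: subset_trans sSG; apply: subsetIl.
have pD : p.-group D by apply: pgroupS pS; apply: subsetIl.
have [H [maxH nilH sNH]] := nilN D sDG pD ntD.
have sDH: D \subset H by apply: subset_trans sNH; rewrite subsetI sDG normG.
have [_ pH _] := pgroup_pdiv pD ntD.
have pH' := dvdn_trans pH (cardSg sDH).
have [sylU _] := nilpotent_maximal_Sylow Op1 maxH nilH pH' p_pr.
set U := ('O_p(H))%G in sylU.
(* Normalisers grow in p-groups, so [V] meets [U] in more than [D] and the induction gives the
   equality. *)
have eqU (V : {group gT}) : p.-Sylow(G) V -> D \subset V -> D != V -> V :=: U.
  move=> sylV sDV neDV; have [sVG pV _] := and3P sylV.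
  have: D \proper 'N_V(D).
    by apply: nilpotent_proper_norm (pgroup_nil pV) _; rewrite properEneq neDV.
  have sNU: 'N_V(D) \subset V :&: U.
    rewrite subsetI subsetIl sub_Hall_pcore ?nilpotent_pcore_Hall //.
      by rewrite (pgroupS (subsetIl _ _)).
    by rewrite (subset_trans _ sNH) ?setSI.
  move/proper_card => ltDN; have ltDVU := leq_trans ltDN (subset_leq_card sNU).
  apply: (IHn V U) => //.
    apply: leq_trans (_ : _ < #|G| - #|S :&: T|) leGn; apply: ltn_sub2l => //.
    by apply: leq_trans ltDVU _; rewrite subset_leq_card // subIset ?sVG.
  by rewrite -cardG_gt1 (leq_trans _ ltDVU) ?ltnS ?cardG_gt0.
have [eqDS | neDS] := eqVneq D S.
  apply/eqP; rewrite eqEcard -{1}eqDS subsetIr.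
  by rewrite (card_Hall sylS) (card_Hall sylT) leqnn.
have [eqDT | neDT] := eqVneq D T.
  apply/esym/eqP; rewrite eqEcard -{1}eqDT subsetIl.
  by rewrite (card_Hall sylS) (card_Hall sylT) leqnn.
have -> := eqU S sylS (subsetIl _ _) neDS.
by have -> := eqU T sylT (subsetIr _ _) neDT.
Qed.

Lemma Sylow_normal_pcore_trivg (gT : finGroupType) (p : nat) (G P : {group gT}) :
    tame_maximals p G -> 'O_p(G) = 1 -> 'O_p^'(G) = 1 -> p.-Sylow(G) P ->
  P <| G.
Proof.
move=> tameG Op1 Op'1 sylP; apply/negPn/negP => not_nsPG.
have [sPG pP _] := and3P sylP.
have ntP: P :!=: 1 by apply: contra not_nsPG => /eqP->; apply: normal1.
have [p_pr _ _] := pgroup_pdiv pP ntP.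
have ntG: G :!=: 1.
  by apply: contra ntP => /eqP G1; rewrite -subG1 -G1.
have [N minN sNG] := minnormal_exists ntG (normG G).
have perfN := perfect_minnormal Op1 Op'1 minN sNG.
have /andP[ntN nNG] := mingroupp minN.
have nsNG: N <| G by apply/andP.
have not_nilN : ~~ nilpotent N.
  by apply: contra ntN => /(nilpotent_normal_trivg Op1 Op'1 nsNG)->.
have [maxM nilM] := Sylow_norm_maximal tameG sylP not_nsPG.
(* With both cores trivial, no nontrivial r-subgroup is normal in [G]. *)
have properN (R : {group gT}) (r : nat) :
    R \subset G -> r.-group R -> R :!=: 1 ->
    exists2 H : {group gT}, maximal H G & 'N_G(R) \subset H.
  move=> sRG rR ntR; have [defG | //] := maximal_exists (subsetIl G 'N(R)).
  have nsRG: R <| G by rewrite /normal sRG -defG subsetIr.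
  by case/eqP: ntR; apply: nilpotent_normal_trivg Op1 Op'1 nsRG (pgroup_nil rR).
have sPN: P \subset N.
  (* If [P] is not in [N], every Sylow subgroup of [N] has a conjugate in ['N_G(P)], which makes [N]
     nilpotent. *)
  apply/negPn/negP=> not_sPN; case/negP: not_nilN; apply: nilpotentS nilM.
  apply: subset_Sylows => r; rewrite mem_primes => /and3P[r_pr _ rN].
  have [R sylR] := Sylow_exists r N; have [sRN rR _] := and3P sylR.
  have sRG := subset_trans sRN sNG.
  have ntR: R :!=: 1.
    by rewrite -cardG_gt1 (card_Hall sylR) p_part_gt1 mem_primes r_pr cardG_gt0.
  have [H maxH sNH] := properN R r sRG rR ntR.
  have not_nsHG := maximal_norm_Sylow_not_normal nsNG sylR maxH sNH.
  have sHG := proper_sub (maxgroupp maxH).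
  have defG: N * H = G.
    apply/eqP; rewrite eqEsubset mul_subG //= -(Frattini_arg nsNG sylR).
    exact: mulgS.
  (* [G / N] is a quotient of [H], and [p] divides its order because [P] is not in [N]. *)
  have pH: p %| #|H|.
    have: p %| #|P / N|.
      have [||//] := @pgroup_pdiv _ p (P / N).
        exact: quotient_pgroup.
      apply: contra not_sPN => /eqP/trivgP.
      by rewrite quotient_sub1 // (subset_trans sPG).
    move/dvdn_trans; apply.
    rewrite (dvdn_trans (cardSg (quotientS N sPG))) //.
    by rewrite /= -defG quotientMidl dvdn_quotient.
  have nilH: nilpotent H by case: (tameG H maxH); rewrite ?(negPf not_nsHG) ?pH.
  have [sylO defH] := nilpotent_maximal_Sylow Op1 maxH nilH pH p_pr.
  have [x Gx defO] := Sylow_trans sylO sylP.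
  exists (R :^ x)%G; first by rewrite pHallJnorm // (subsetP nNG).
  rewrite /= defO -(conjGid Gx) normJ -conjIg conjSg defH.
  by apply: subset_trans sNH; rewrite subsetI sRG normG.
have nilN (D : {group gT}) : D \subset G -> p.-group D -> D :!=: 1 ->
    exists H : {group gT}, [/\ maximal H G, nilpotent H & 'N_G(D) \subset H].
  move=> sDG pD ntD; have [H maxH sNH] := properN D p sDG pD ntD.
  have [S sylS sDS] := Sylow_superset sDG pD.
  have sDH : D \subset H by apply: subset_trans sNH; rewrite subsetI sDG normG.
  exists H; split=> //; case: (tameG H maxH) => // [nsHG | /negP[]]; last first.
    by have [_ pD' _] := pgroup_pdiv pD ntD; apply: dvdn_trans pD' (cardSg sDH).
  have sNH' := perfect_sub_normal_maximal perfN sNG maxH nsHG.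
  have [x Gx defS] := Sylow_trans sylP sylS.
  have not_nsSG : ~~ (S <| G).
    by apply: contra not_nsPG; rewrite defS -{1}(conjGid Gx) normalJ.
  have [_ nilNS] := Sylow_norm_maximal tameG sylS not_nsSG.
  (* A normal [H] contains [N], hence [S], and also ['C_G(S)] through ['N_G(D)]; these cover
     ['N_G(S)], which no normal maximal subgroup contains. *)
  suffices sNSH: 'N_G(S) \subset H.
    have nsGG := normal_refl G.
    by case/negP: (maximal_norm_Sylow_not_normal nsGG sylS maxH sNSH).
  apply: subset_trans (nilpotent_norm_Sylow_sub nilNS sylS) _; rewrite mul_subG //.
    by apply: subset_trans sNH'; rewrite defS -(normsP nNG x Gx) conjSg.
  apply: subset_trans sNH; rewrite setIS //.
  by rewrite (subset_trans (centS sDS)) ?cent_sub.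
have ntP' : P :&: G^`(1) = P.
  by apply/setIidPl; apply: subset_trans sPN _; rewrite -perfN dergS.
(* A nontrivial p-group properly contains its derived subgroup, so the transfer lemma reduces the
   contradiction to its fusion condition. *)
have /andP[_ /negP[]] := sol_der1_proper (pgroup_sol pP) (subxx P) ntP.
rewrite -{1}ntP'; apply: (der1_setI_Sylow sylP) => x g Px Gg Pxg.
have [-> | ntx] := eqVneq x 1; first by rewrite comm1g group1.
have eqPg : P :^ g = P.
  apply/esym/(Sylow_TI Op1 p_pr nilN sylP); first by rewrite pHallJ.
  apply/trivgPn; exists (x ^ g); last by rewrite conjg_eq1.
  by rewrite inE Pxg memJ_conjg.
(* [g] is an element of [P] times one centralising [P]; only the former affects the commutator with
   [x]. *)
have: g \in P * 'C_G(P).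
  by rewrite (subsetP (nilpotent_norm_Sylow_sub nilM sylP)) // !inE Gg eqPg subxx.
case/mulsgP=> h a Ph /setIP[_ cPa] ->.
have -> : [~ x, h * a] = [~ x, h].
  rewrite !commgEl conjgM [(x ^ h) ^ a]conjgE.
  by rewrite -(centP cPa (x ^ h)) ?groupJ // mulKg.
by rewrite mem_commg.
Qed.

(** * Reduction to trivial cores and p-nilpotency *)

(** Frattini argument with Schur-Zassenhaus conjugacy: each [G]-conjugate of [K] is a complement of
    [Z] in [Z * K], hence conjugate to [K] under [Z]. *)
Lemma complement_Frattini (gT : finGroupType) (G Z K : {group gT}) :
    solvable Z -> Z <| G -> K \subset G -> coprime #|Z| #|K| -> Z * K <| G ->
  Z * 'N_G(K) = G.
Proof.
move=> solZ nsZG sKG coZK /andP[_ nZKG]; have [sZG nZG] := andP nsZG.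
apply/eqP; rewrite eqEsubset mul_subG ?subsetIl //=; apply/subsetP=> g Gg.
have sKgZK: K :^ g \subset Z * K.
  by rewrite -(normsP nZKG g Gg) conjSg mulG_subr.
have [z Zz eqKg] := SchurZassenhaus_trans_sol solZ (subset_trans sKG nZG) sKgZK
  coZK (cardJg K g).
have Gz := subsetP sZG z Zz.
rewrite -(mulgKV z g) -normC ?(subset_trans (subsetIl _ _)) //.
rewrite mem_mulg // !inE groupM ?groupV //=.
by rewrite conjsgM eqKg conjsgK.
Qed.

(** p-nilpotency is encoded as the quotient by the p'-core being a p-group. *)
Lemma tame_p_nilpotent (gT : finGroupType) (p : nat) (G P : {group gT}) :
    tame_maximals p G -> p.-Sylow(G) P -> ~~ (P <| G) ->
  p.-group (G / 'O_p^'(G)).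
Proof.
have [n] := ubnP #|G|; elim: n => // n IHn in gT G P * => /ltnSE-leGn.
move=> tameG sylP not_nsPG; have [sPG pP _] := and3P sylP.
have [_ nilM] := Sylow_norm_maximal tameG sylP not_nsPG.
have IHq (N : {group gT}) : N <| G -> N :!=: 1 -> ~~ (P / N <| G / N) ->
    p.-group (G / N / 'O_p^'(G / N)).
  move=> nsNG ntN not_nsPGN.
  apply: (IHn _ (G / N)%G (P / N)%G) => //.
  - by apply: leq_trans leGn; rewrite ltn_quotient ?normal_sub.
  - exact: tame_quotient.
  by apply: quotient_pHall => //; rewrite (subset_trans sPG) ?normal_norm.
set N := 'O_p^'(G); have nsNG : N <| G by apply: pcore_normal.
have [nsPNG | not_nsPNG] := boolP (P / N <| G / N).
  have nNP := subset_trans sPG (normal_norm nsNG).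
  (* Frattini gives this factorisation, so [G / N] is nilpotent; its p'-core is trivial, so it is a
     p-group. *)
  have defG: N * 'N_G(P) = G.
    have nsNPG : N <*> P <| G.
      by move: nsPNG; rewrite -cosetpre_normal (quotientGK nsNG) quotientYK.
    have sylP' : p.-Sylow(N <*> P) P.
      by apply: pHall_subl sylP; rewrite ?joing_subr ?normal_sub.
    have:= Frattini_arg nsNPG sylP'.
    by rewrite /= norm_joinEr // -mulgA mulSGid // subsetI sPG normG.
  have nilGN : nilpotent (G / N) by rewrite -defG quotientMidl quotient_nil.
  rewrite -(nilpotent_pcoreC p nilGN) trivg_pcore_quotient dprodg1.
  exact: pcore_pgroup.
have [N1 | ntN] := eqVneq N 1; last first.
  have := IHq _ nsNG ntN not_nsPNG.
  by rewrite trivg_pcore_quotient pquotient_pgroup ?norms1 ?pgroup1.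
set Z := 'O_p(G); have nsZG : Z <| G by apply: pcore_normal.
have [Z1 | ntZ] := eqVneq Z 1.
  by case/negP: not_nsPG; apply: Sylow_normal_pcore_trivg sylP.
have [sZG nZG] := andP nsZG.
have sZP : Z \subset P by apply: pcore_sub_Hall.
have nsZP : Z <| P by apply: normalS nsZG.
have not_nsPGZ : ~~ (P / Z <| G / Z).
  by apply: contra not_nsPG; rewrite -cosetpre_normal !quotientGK.
have := IHq _ nsZG ntZ not_nsPGZ; set Kb := 'O_p^'(G / Z) => pGKb.
pose K := (coset Z @*^-1 Kb)%G.
have nsKbG : Kb <| G / Z by apply: pcore_normal.
have nsKG : K <| G by rewrite -(quotientGK nsZG) cosetpre_normal.
have sZK : Z \subset K by apply: sub_cosetpre.
have nsZK : Z <| K := normalS sZK (normal_sub nsKG) nsZG.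
have defKb : K / Z = Kb by rewrite cosetpreK.
have hallZ : p.-Hall(K) Z.
  rewrite /pHall sZK pcore_pgroup -card_quotient ?normal_norm //= defKb.
  exact: pcore_pgroup.
have /splitsP[K0 complK0] := SchurZassenhaus_split (pHall_Hall hallZ) nsZK.
have p'K0 : p^'.-group K0.
  by move: complK0; rewrite (compl_pHall _ hallZ) => /pHall_pgroup.
have [tiZK0 defK] := complP complK0.
have sK0K : K0 \subset K by rewrite -defK mulG_subr.
have sK0G := subset_trans sK0K (normal_sub nsKG).
have coZK0 : coprime #|Z| #|K0| := pnat_coprime (pcore_pgroup _ _) p'K0.
have solZ : solvable Z := pgroup_sol (pcore_pgroup _ _).
have defG : Z * 'N_G(K0) = G by apply: complement_Frattini; rewrite ?defK.
(* If [K0] is normal in [G] it lies in the trivial p'-core, so [G / Z] is a p-group, equal to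
   [P / Z]. *)
have [defN | [H maxH sNH]] := maximal_exists (subsetIl G 'N(K0)).
  case/negP: not_nsPGZ.
  have K01 : K0 :=: 1.
    apply/trivgP; rewrite -N1 pcore_max // /normal sK0G.
    by rewrite -{1}defN subsetIr.
  have Kb1 : Kb = 1 by rewrite -defKb -defK K01 mulg1 trivg_quotient.
  have pG : p.-group (G / Z).
    by move: pGKb; rewrite Kb1 pquotient_pgroup ?norms1 ?pgroup1.
  rewrite (pHall_id _ pG) ?normal_refl //.
  by apply: quotient_pHall; rewrite // (subset_trans sPG).
have [sHG _] := andP (maxgroupp maxH).
have defGH : Z * H = G.
  by apply/eqP; rewrite eqEsubset mul_subG //= -{1}defG mulgS.
have sylPZ : p.-Sylow(G / Z) (P / Z).
  by apply: quotient_pHall; rewrite // (subset_trans sPG).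
have defGZ : G / Z = H / Z by rewrite -defGH quotientMidl.
case: (tameG H maxH) => [nilH | nsHG | p'H].
- have nilGZ : nilpotent (G / Z) by rewrite defGZ quotient_nil.
  case/negP: not_nsPGZ.
  by rewrite (nilpotent_Hall_pcore nilGZ sylPZ) pcore_normal.
- have sK0H : K0 \subset H.
    by apply: subset_trans sNH; rewrite subsetI sK0G normG.
  have defKH : (Z :&: H) * K0 = K :&: H.
    by rewrite setIC group_modr ?defK 1?setIC.
  (* With [H] normal, the same Frattini argument for [Z :&: H] puts [G] inside [H]. *)
  have defG' : (Z :&: H) * 'N_G(K0) = G.
    apply: complement_Frattini => //.
    - by apply: solvableS solZ; apply: subsetIl.
    - exact: normalI.
    - by apply: coprimeSg coZK0; apply: subsetIl.
    by rewrite defKH; apply: (normalI nsKG nsHG).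
  have /andP[_ /negP[]] := maxgroupp maxH.
  by have := mul_subG (subsetIr Z H) sNH; rewrite defG'.
case/negP: not_nsPGZ; suffices -> : P / Z = 1 by apply: normal1.
have p'HZ : p^'.-group (H / Z).
  by apply: quotient_pgroup; rewrite p'groupEpi mem_primes !negb_and p'H !orbT.
rewrite -(setIid (P / Z)) coprime_TIg //.
apply: pnat_coprime (quotient_pgroup _ pP) _; apply: pgroupS p'HZ.
by rewrite /= -defGZ quotientS.
Qed.

(** * Towers of normal Hall subgroups *)

Lemma pcore_Hall_primes (gT : finGroupType) (pi : nat_pred) (G : {group gT}) :
    {in pi, forall r, r.-Sylow(G) 'O_r(G)} ->
  pi.-Hall(G) 'O_pi(G).
Proof.
move=> sylO; rewrite /pHall pcore_sub pcore_pgroup /=.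
apply/pnatP=> // r r_pr r_dv; apply/negP=> /= pi_r.
have sOO : 'O_r(G) \subset 'O_pi(G).
  by rewrite pcore_max ?pcore_normal ?(pi_pgroup (pcore_pgroup r G)).
have /and3P[_ _] := sylO r pi_r; rewrite p'natE // => /negP[].
exact: dvdn_trans r_dv (indexgS G sOO).
Qed.

Lemma pcore_Hall_quotient (gT : finGroupType) (pi : nat_pred)
    (G N : {group gT}) :
    N <| G -> pi.-group N -> pi.-Hall(G / N) 'O_pi(G / N) ->
  pi.-Hall(G) 'O_pi(G).
Proof.
move=> nsNG piN; rewrite (pquotient_pcore nsNG piN) pquotient_pHall //.
by rewrite (normalS _ _ nsNG) ?pcore_sub ?pcore_max.
Qed.

(* Unlike [sylow_tower], this form passes from quotients to G. *)
Definition pcore_tower (gT : finGroupType) (G : {group gT}) : Prop :=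
  exists2 s : seq nat, perm_eq s (primes #|G|) &
    forall i, [pred q in take i s].-Hall(G) 'O_[pred q in take i s](G).

(** Any choice of Sylow subgroups works: a normal Hall subgroup contains all Sylow subgroups for its
    primes, so by induction each partial product is the corresponding core. *)
Lemma pcore_tower_sylow_tower (gT : finGroupType) (G : {group gT}) :
  pcore_tower G -> sylow_tower G.
Proof.
case=> s perm_s hallO; pose P q : {group gT} := sval (Sylow_exists q G).
have sylP q : q.-Sylow(G) (P q) := svalP (Sylow_exists q G).
have uniq_s : uniq s by rewrite (perm_uniq perm_s) primes_uniq.
have prodP i : i <= size s ->
    \prod_(q <- take i s) (P q : {set gT}) = 'O_[pred q in take i s](G).
  elim: i => [_ | i IHi lt_i_s].
    rewrite take0 big_nil; apply/esym/trivgP.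
    apply: (@subset_Sylows _ 1%G 'O_[pred q in [::]](G)%G) => r.
    by move/(pnatPpi (pcore_pgroup _ _)).
  rewrite (take_nth 0%N lt_i_s) -cats1 big_cat big_seq1 /= IHi 1?ltnW //.
  set q := nth 0%N s i; set pi := [pred q in take i s].
  set pi' := [pred q0 in take i s ++ [:: q]].
  have pi'E r : (r \in pi') = (r \in pi) || (r == q).
    by rewrite !inE mem_cat inE.
  have hallO' : pi'.-Hall(G) 'O_pi'(G).
    by have := hallO i.+1; rewrite (take_nth 0%N lt_i_s) -cats1.
  have [sPG qP _] := and3P (sylP q).
  have sPO : P q \subset 'O_pi'(G).
    by rewrite (sub_Hall_pcore hallO') // (pi_pgroup qP) // pi'E eqxx orbT.
  have sOO : 'O_pi(G) \subset 'O_pi'(G).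
    by apply: sub_pcore => r pi_r; rewrite pi'E pi_r.
  rewrite -norm_joinEr ?(subset_trans sPG) ?gFnorm //.
  apply/eqP; rewrite eqEsubset join_subG sOO sPO /=.
  apply: subset_Sylows => r /(pnatPpi (pcore_pgroup _ _)); rewrite pi'E.
  case/orP=> [pi_r | /eqP->].
    have [R sylR] := Sylow_exists r 'O_pi'(G); exists R => //.
    have [sRO rR _] := and3P sylR; apply: subset_trans (joing_subl _ _).
    rewrite (sub_Hall_pcore (hallO i)) ?(pi_pgroup rR) //.
    by rewrite (subset_trans sRO) ?pcore_sub.
  exists (P q); last exact: joing_subr.
  by apply: pHall_subl (sylP q); rewrite ?pcore_sub.
exists s, P; split=> // [i le_i_s|].
  by rewrite prodP // groupP pcore_normal.
have := prodP (size s) (leqnn _); rewrite take_size => ->.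
apply: pcore_pgroup_id; apply: sub_pgroup (pgroup_pi G) => r.
by rewrite !inE (perm_mem perm_s).
Qed.

(** The primes with normal Sylow subgroup are listed first; past them, the cores contain ['O_cl(G)]
    and lift from the nilpotent quotient. *)
Lemma nilpotent_quotient_pcore_tower (gT : finGroupType) (G : {group gT}) :
    let cl := [pred r | r.-Sylow(G) 'O_r(G)] in
  nilpotent (G / 'O_cl(G)) -> pcore_tower G.
Proof.
move=> cl nilGO; pose s1 := filter cl (primes #|G|).
pose s2 := filter (predC cl) (primes #|G|).
exists (s1 ++ s2); first by rewrite perm_filterC.
move=> i; set pi := [pred q in _]; have [le_i | lt_i] := leqP i (size s1).
  apply: pcore_Hall_primes => r; rewrite !inE takel_cat // => /mem_take.
  by rewrite mem_filter => /andP[].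
apply: (@pcore_Hall_quotient _ _ _ 'O_cl(G)); last exact: nilpotent_pcore_Hall.
  exact: pcore_normal.
apply/pgroupP=> r r_pr r_dv; rewrite !inE take_cat ltnNge (ltnW lt_i) /= mem_cat.
rewrite mem_filter; apply/orP; left; apply/andP; split.
  by apply: (pnatPpi (pcore_pgroup cl G)); rewrite mem_primes r_pr cardG_gt0.
by rewrite mem_primes r_pr cardG_gt0 (dvdn_trans r_dv) ?cardSg ?pcore_sub.
Qed.

(** * Nilpotency modulo the normal Sylow subgroups *)

Lemma tame_nilpotent_quotient (gT : finGroupType) (p : nat) (G P : {group gT}) :
    let cl := [pred r | r.-Sylow(G) 'O_r(G)] in
    tame_maximals p G -> p.-Sylow(G) P -> ~~ (P <| G) ->
  nilpotent (G / 'O_cl(G)).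
Proof.
move=> cl tameG sylP not_nsPG; have [sPG pP _] := and3P sylP.
have [maxM nilM] := Sylow_norm_maximal tameG sylP not_nsPG.
have pGN := tame_p_nilpotent tameG sylP not_nsPG.
set N := 'O_p^'(G) in pGN; have nsNG : N <| G := pcore_normal _ _.
have hallN : p^'.-Hall(G) N.
  rewrite /pHall normal_sub // pcore_pgroup -card_quotient ?normal_norm //=.
  by rewrite pnatNK.
have nNP := subset_trans sPG (normal_norm nsNG).
have coNP : coprime #|N| #|P|.
  by rewrite coprime_sym (pnat_coprime pP (pcore_pgroup _ _)).
set T := 'O_cl(G).
have nTM : 'N_G(P) \subset 'N(T) by rewrite subIset ?gFnorm.
have defG : T * 'N_G(P) = G.
  apply/eqP; rewrite -norm_joinEr // eqEsubset join_subG pcore_sub subsetIl /=.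
  apply: subset_Sylows => r _.
  have [cl_r | not_cl_r] := boolP (r \in cl).
    exists 'O_r(G)%G => //; apply: subset_trans (joing_subl _ _).
    by rewrite pcore_max ?pcore_normal ?(pi_pgroup (pcore_pgroup r G)).
  suffices [R sylR sRM] :
      exists2 R : {group gT}, r.-Sylow(G) R & R \subset 'N_G(P).
    by exists R; rewrite ?(subset_trans sRM) ?joing_subr.
  have [-> | neq_rp] := eqVneq r p.
    by exists P; rewrite // subsetI sPG normG.
  (* Coprime action of [P] on the p'-core provides a [P]-invariant Sylow r-subgroup, which is Sylow
     in [G]. *)
  have [R sylRN nRP] := sol_coprime_Sylow_exists r (pgroup_sol pP) nNP coNP.
  have sylR : r.-Sylow(G) R by apply: subHall_Sylow hallN _ sylRN; rewrite !inE.
  exists R => //; have sRG := pHall_sub sylR.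
  have [defN | [H maxH sNH]] := maximal_exists (subsetIl G 'N(R)).
    have nsRG : R <| G by rewrite /normal sRG -{1}defN subsetIr.
    by case/negP: not_cl_r; rewrite inE (normal_Hall_pcore sylR).
  have [sHG _] := andP (maxgroupp maxH).
  have sPH : P \subset H by apply: subset_trans sNH; rewrite subsetI sPG.
  have nilH : nilpotent H.
    have [//|nsHG|/negP[]] := tameG H maxH.
      have nsGG := normal_refl G.
      by case/negP: (maximal_norm_Sylow_not_normal nsGG sylR maxH sNH).
    have ntP : P :!=: 1 by apply: contra not_nsPG => /eqP->; apply: normal1.
    by have [_ pP' _] := pgroup_pdiv pP ntP; apply: dvdn_trans pP' (cardSg sPH).
  (* [P] is normal in the nilpotent [H], and [R] lies in [H]. *)
  rewrite subsetI sRG (nilpotent_Hall_pcore nilH (pHall_subl sPH sHG sylP)).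
  apply: subset_trans (gFnorm _ _); apply: subset_trans sNH.
  by rewrite subsetI sRG normG.
by rewrite -defG quotientMidl quotient_nil.
Qed.

(** The hypothesis implies [tame_maximals r] for every [r], so any prime with a non-normal Sylow
    subgroup can serve. *)
Lemma nilpotent_or_normal_maximals_pcore_tower (gT : finGroupType)
    (G : {group gT}) :
    (forall M : {group gT}, maximal M G -> nilpotent M \/ M <| G) ->
  pcore_tower G.
Proof.
move=> maxG; apply: nilpotent_quotient_pcore_tower.
set cl := [pred r | _].
have [/allP clG | /allPn[r _ not_cl_r]] := boolP (all cl (primes #|G|)).
  rewrite pcore_pgroup_id ?trivg_quotient ?nilpotent1 //.
  by apply: sub_pgroup (pgroup_pi G) => r; apply: clG.
have [R sylR] := Sylow_exists r G; apply: (@tame_nilpotent_quotient _ r _ R) => //.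
  by move=> M /maxG[]; [constructor 1 | constructor 2].
by apply: contra not_cl_r => nsRG; rewrite inE (normal_Hall_pcore sylR).
Qed.

Theorem theorem1p4 (gT : finGroupType) (G : {group gT}) (p : nat) :
  prime p -> p %| #|G| ->
  (forall M : {group gT}, maximal M G ->
     [\/ nilpotent M, (M <| G)%g | ~~ (p %| #|M|)]) ->
  sylow_tower G.
Proof.
move=> p_pr pG tameG; apply: pcore_tower_sylow_tower.
have [P sylP] := Sylow_exists p G; have [sPG pP _] := and3P sylP.
have [nsPG | not_nsPG] := boolP (P <| G); last first.
  apply: nilpotent_quotient_pcore_tower.
  exact: tame_nilpotent_quotient tameG sylP not_nsPG.
have ntP : P :!=: 1.
  by rewrite -cardG_gt1 (card_Hall sylP) p_part_gt1 mem_primes p_pr cardG_gt0.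
have [_ pP' _] := pgroup_pdiv pP ntP.
(* Preimages of maximal subgroups of [G / P] contain [P], so their orders are divisible by [p]. *)
have [s perm_s hallO] : pcore_tower (G / P)%G.
  apply: nilpotent_or_normal_maximals_pcore_tower => M maxM.
  pose H := (coset P @*^-1 M)%G.
  have maxH : maximal H G by rewrite -(quotientGK nsPG) cosetpre_maximal.
  have sPH : P \subset H by apply: sub_cosetpre.
  have nsPH : P <| H by rewrite (normalS _ _ nsPG) ?(proper_sub (maxgroupp maxH)).
  have defM : M :=: H / P by rewrite cosetpreK.
  case: (tameG H maxH) => [nilH | nsHG | /negP[]].
  - by left; rewrite defM quotient_nil.
  - by right; rewrite defM quotient_normal.
  by apply: dvdn_trans pP' (cardSg sPH).
have oG : #|G| = (#|P| * #|G / P|)%N.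
  by rewrite card_quotient ?normal_norm // Lagrange.
have p'GP : p^'.-group (G / P).
  by have [_ _] := and3P sylP; rewrite -card_quotient ?normal_norm.
have not_sp : p \notin s.
  by rewrite (perm_mem perm_s) -[_ \in _]/(p \in \pi(G / P)) -p'groupEpi.
(* With [p] at the head, every nonempty segment gives a core containing [P], which lifts from
   [G / P]. *)
exists (p :: s).
  apply: uniq_perm; rewrite ?primes_uniq //=.
    by rewrite not_sp (perm_uniq perm_s) primes_uniq.
  move=> r; rewrite inE (perm_mem perm_s) oG primesM ?cardG_gt0 //.
  have [_ _ [k ->]] := pgroup_pdiv pP ntP.
  by rewrite primesX // (primes_prime p_pr) inE.
case=> [|i]; first by apply: pcore_Hall_primes.
set pi := [pred q in _].
have piP : pi.-group P by apply: pi_pgroup pP _; rewrite !inE eqxx.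
apply: (pcore_Hall_quotient nsPG piP).
have eq_pi : {in \pi(G / P), pi =i [pred q in take i s]}.
  move=> r piGr; rewrite !inE; case: eqP => //= eq_rp.
  by rewrite p'groupEpi -eq_rp piGr in p'GP.
by rewrite (eq_in_pcore eq_pi) (eq_in_pHall _ eq_pi).
Qed.
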